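(* Let $R$ be a ring such that, for every positive integer $n$, every $n$-absorbing ideal of $R$ is a strongly $n$-absorbing ideal of $R$, and let $B$ be a content $R$-algebra. If $I$ is a radical ideal of $R$, then $\omega_B(IB)=\omega_R(I)$.
   Context: All rings are commutative with identity $1\neq 0$, and algebras are commutative with identity. An ideal $I$ is radical if $I=\sqrt{I}$. Content algebras. Let $R$ be a ring and $B$ an $R$-algebra. For $f\in B$, the content of $f$ is the ideal $c(f)=\bigcap\{J : J \text{ is an ideal of } R \text{ and } f\in JB\}$ of $R$. The $R$-algebra $B$ is called a content $R$-algebra if: (1) $f\in c(f)B$ for all $f\in B$; (2) $c(rf)=r\,c(f)$ for all $r\in R$, $f\in B$, and $c(1_B)=R$; (3) for all $f,g\in B$ there exists an integer $n\geq 1$ such that $c(f)^n c(g)=c(f)^{n-1}c(fg)$ (with the convention that the zeroth power of an ideal is $R$). $n$-absorbing ideals. For a positive integer $n$, a proper ideal $I$ of a ring $R$ is an $n$-absorbing ideal of $R$ if whenever $x_1\cdots x_{n+1}\in I$ for $x_1,\ldots,x_{n+1}\in R$, then there are $n$ of the $x_i$'s whose product is in $I$. A proper ideal $I$ of $R$ is a strongly $n$-absorbing ideal if whenever $I_1\cdots I_{n+1}\subseteq I$ for ideals $I_1,\ldots,I_{n+1}$ of $R$, then there are $n$ of the $I_i$'s whose product is contained in $I$. For a proper ideal $I$ of $R$, $\omega_R(I)=\min\{n\geq 1 : I \text{ is an } n\text{-absorbing ideal of } R\}$, with $\omega_R(I)=\infty$ if $I$ is not $n$-absorbing for any positive integer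 $n$; moreover $\omega_R(R)=0$. *)

(* Defs.v *)
From mathcomp Require Import all_boot all_algebra.
From mathcomp Require Import boolp classical_sets.

Set Implicit Arguments.
Unset Strict Implicit.
Unset Printing Implicit Defensive.

Import GRing.Theory.

Local Open Scope classical_set_scope.
Local Open Scope ring_scope.

(* Ideals are arbitrary classical sets, and the whole ring is an ideal: the
   predicate [idealr_closed] of ring_quotient only covers proper ideals. *)
Definition ideal (R : comNzRingType) (I : set R) : Prop :=
  [/\ I 0, forall x y, I x -> I y -> I (x + y)
    & forall r x, I x -> I (r * x)].

Definition proper_ideal (R : comNzRingType) (I : set R) : Prop :=
  ideal I /\ I <> setT.

Definition ideal_span (R : comNzRingType) (S : set R) : set R :=
  \bigcap_(J in [set J | ideal J /\ S `<=` J]) J.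

Definition ideal_mul (R : comNzRingType) (I J : set R) : set R :=
  ideal_span [set x * y | x in I & y in J].

(* The empty product of ideals is the whole ring. *)
Definition ideal_exp (R : comNzRingType) (I : set R) (n : nat) : set R :=
  \big[@ideal_mul R/setT]_(i < n) I.

Definition radical (R : comNzRingType) (I : set R) : set R :=
  [set x | exists2 n, (0 < n)%N & I (x ^+ n)].

Definition radical_ideal (R : comNzRingType) (I : set R) : Prop :=
  ideal I /\ I = radical I.

(* The ideal JB; the structure map R -> B is r |-> r%:A. *)
Definition ideal_ext (R : comNzRingType) (B : comAlgType R) (J : set R) :
    set B :=
  ideal_span [set r%:A | r in J].
Arguments ideal_ext {R} B J.

Definition content (R : comNzRingType) (B : comAlgType R) (f : B) : set R :=
  \bigcap_(J in [set J | ideal J /\ ideal_ext B J f]) J.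

Definition content_algebra (R : comNzRingType) (B : comAlgType R) : Prop :=
  [/\ forall f : B, ideal_ext B (content f) f,
      (forall (r : R) (f : B), content (r *: f) = [set r * a | a in content f])
        /\ content (1 : B) = setT
    & forall f g : B, exists2 n, (0 < n)%N
        & ideal_mul (ideal_exp (content f) n) (content g)
          = ideal_mul (ideal_exp (content f) n.-1) (content (f * g))].

(* The next two notions are only meaningful for n > 0. *)
Definition n_absorbing (R : comNzRingType) (n : nat) (I : set R) : Prop :=
  proper_ideal I /\
  forall x : 'I_n.+1 -> R, I (\prod_i x i) ->
    exists2 A : {set 'I_n.+1}, #|A| = n & I (\prod_(i in A) x i).

Definition strongly_n_absorbing (R : comNzRingType) (n : nat) (I : set R) :
    Prop :=
  proper_ideal I /\
  forall J : 'I_n.+1 -> set R, (forall i, ideal (J i)) ->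
    \big[@ideal_mul R/setT]_i J i `<=` I ->
    exists2 A : {set 'I_n.+1}, #|A| = n
      & \big[@ideal_mul R/setT]_(i in A) J i `<=` I.

(* The value lives in the naturals extended with infinity, [None] standing for
   infinity. *)
Definition omega (R : comNzRingType) (I : set R) : option nat :=
  if `[< I = setT >] then Some 0%N else
  if pselect (exists n, `[< (0 < n)%N /\ n_absorbing n I >]) is left exn
  then Some (ex_minn exn) else None.

(* Main.v *)
(** By content axiom (1), [f] lies in [JB] iff [content f] is contained in [J],
    and by axiom (2) [JB] contracts to [J] in [R]; hence [IB] being n-absorbing
    implies the same for [I].  Conversely axiom (3) gives
    [content f * content g] contained in the radical of [content (f * g)], so for
    a radical ideal [I] a product of the [f_i] in [IB] forces the product of the
    ideals [content f_i] into [I].  Strong n-absorption selects n of these ideals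
    with product in [I], and the product of the corresponding [f_i] is in [IB]. *)
Require Import Defs.
From mathcomp Require Import all_boot all_algebra.
From mathcomp Require Import boolp classical_sets.
From mathcomp Require Import ring.

Set Implicit Arguments.
Unset Strict Implicit.
Unset Printing Implicit Defensive.

Import GRing.Theory.

Local Open Scope classical_set_scope.
Local Open Scope ring_scope.

Section Ideals.
Variable R : comNzRingType.
Implicit Types (I J K S : set R).

Lemma ideal_bigcap (D : set (set R)) :
  (forall J, D J -> ideal J) -> ideal (\bigcap_(J in D) J).
Proof.
move=> idD; split=> [J /idD[] // | x y Ix Iy J DJ | r x Ix J DJ];
  have [_ addJ mulJ] := idD _ DJ.
  by apply: addJ; [apply: Ix | apply: Iy].
by apply: mulJ; apply: Ix.
Qed.

Lemma ideal_span_ideal S : ideal (ideal_span S).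
Proof. by apply: ideal_bigcap => J []. Qed.

Lemma sub_ideal_span S : S `<=` ideal_span S.
Proof. by move=> x Sx J [_]; apply. Qed.

Lemma ideal_span_sub S J : ideal J -> S `<=` J -> ideal_span S `<=` J.
Proof. by move=> idJ sSJ x; apply. Qed.

(** With this, a claim that products lie in an ideal can be checked on generators of one factor
    while the other is held fixed. *)
Lemma ideal_colon J (c : R) : ideal J -> ideal [set x | J (c * x)].
Proof.
case=> J0 addJ mulJ; split=> /= [|x y|r x]; first by rewrite mulr0.
  by rewrite mulrDr; apply: addJ.
by rewrite mulrCA; apply: mulJ.
Qed.

Lemma ideal_eqT J : ideal J -> J 1 -> J = setT.
Proof.
case=> _ _ mulJ J1; apply/seteqP; split=> // x _.
by rewrite -[x]mulr1; apply: mulJ.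
Qed.

Lemma mem_ideal_mul I J x y : I x -> J y -> ideal_mul I J (x * y).
Proof. by move=> Ix Jy; apply: sub_ideal_span; exists x => //; exists y. Qed.

Lemma ideal_mul_sub I J K : ideal K ->
  (forall x y, I x -> J y -> K (x * y)) -> ideal_mul I J `<=` K.
Proof.
by move=> idK sK; apply: ideal_span_sub => // _ [x Ix [y Jy <-]]; apply: sK.
Qed.

Lemma mem_ideal_exp I n x : I x -> ideal_exp I n (x ^+ n).
Proof.
move=> Ix; rewrite /ideal_exp -[n in _ ^+ n]card_ord -prodr_const.
by apply: (big_rec2 (fun (K : set R) y => K y)) => // i y K _ Ky; apply: mem_ideal_mul.
Qed.

End Ideals.

Section ContentAlgebra.
Variables (R : comNzRingType) (B : comAlgType R).
Implicit Types (I J K : set R) (f g : B).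

Lemma ideal_ext_ideal J : ideal (ideal_ext B J).
Proof. exact: ideal_span_ideal. Qed.

Lemma mem_ideal_ext J r : J r -> ideal_ext B J r%:A.
Proof. by move=> Jr; apply: sub_ideal_span; exists r. Qed.

Lemma ideal_ext_mono J K : J `<=` K -> ideal_ext B J `<=` ideal_ext B K.
Proof.
move=> sJK; apply: (ideal_span_sub (ideal_ext_ideal K)).
by move=> _ [r Jr <-]; apply: mem_ideal_ext; apply: sJK.
Qed.

Lemma ideal_ext_mul J K f g : ideal_ext B J f -> ideal_ext B K g ->
  ideal_ext B (ideal_mul J K) (f * g).
Proof.
move=> Jf Kg; have idJK := ideal_ext_ideal (ideal_mul J K).
(* First [g] is reduced to a generator [s%:A], then [f] to a generator [r%:A]. *)
apply: (ideal_span_sub (ideal_colon f idJK) _ Kg) => _ [s Ks <-] /=.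
rewrite mulrC.
apply: (ideal_span_sub (ideal_colon s%:A idJK) _ Jf) => _ [r Jr <-] /=.
rewrite mulr_algl scalerA mulrC.
by apply: mem_ideal_ext; apply: mem_ideal_mul.
Qed.

Lemma ideal_ext_prod (T : finType) (P : pred T) (J : T -> set R) (f : T -> B) :
  (forall i, ideal_ext B (J i) (f i)) ->
  ideal_ext B (\big[@ideal_mul R/setT]_(i | P i) J i) (\prod_(i | P i) f i).
Proof.
move=> Jf; apply: (big_rec2 (fun K g => ideal_ext B K g)) => [|i g K _ Kg].
  by rewrite -[1 : B]scale1r; apply: mem_ideal_ext.
exact: ideal_ext_mul.
Qed.

Lemma content_ideal f : ideal (content f).
Proof. by apply: ideal_bigcap => J []. Qed.

Lemma content_sub J f : ideal J -> ideal_ext B J f -> content f `<=` J.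
Proof. by move=> idJ Jf x; apply. Qed.

Hypothesis hB : content_algebra B.

(** By axiom (2) the content of [r%:A] is [r] times the content of [1], the principal ideal of [r],
    and it lies in [J]. *)
Lemma ideal_ext_alg J r : ideal J -> ideal_ext B J r%:A -> J r.
Proof.
move=> idJ /(content_sub idJ); apply; have [_ [-> ->] _] := hB.
by exists 1 => //; rewrite mulr1.
Qed.

Lemma ideal_ext_eqT J : ideal J -> ideal_ext B J = setT <-> J = setT.
Proof.
move=> idJ; split=> JT.
  by apply: ideal_eqT => //; apply: ideal_ext_alg; rewrite ?JT.
apply: ideal_eqT; first exact: ideal_ext_ideal.
by rewrite -[1 : B]scale1r; apply: mem_ideal_ext; rewrite JT.
Qed.

Lemma content_mul_radical I f g (a x y : R) : radical_ideal I ->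
  (forall z, content (f * g) z -> I (a * z)) ->
  content f x -> content g y -> I (a * x * y).
Proof.
case=> -[_ _ mulI] -> sI fx gy.
(* The exponent of axiom (3) is written [n.+1], so the right-hand side carries the power [n] and
   lies in [content (f * g)]. *)
have [_ _ /(_ f g)[[//|n] _ Efg]] := hB.
have : content (f * g) (x ^+ n.+1 * y).
  have := mem_ideal_mul (mem_ideal_exp n.+1 fx) gy; rewrite Efg.
  have idfg := content_ideal (f * g).
  by apply: ideal_mul_sub => // u v _; have [_ _] := idfg; apply.
(* Since [I] has been replaced by its radical, some power of [a * x * y] in [I] suffices: its power
   [n.+1] is a multiple of [a * (x ^+ n.+1 * y)], whose power [m] lies in [I]. *)
move=> /sI[m m_gt0 Im]; exists (n.+1 * m)%N; first by rewrite muln_gt0.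
have -> : (a * x * y) ^+ (n.+1 * m) =
    ((a * y) ^+ n) ^+ m * (a * (x ^+ n.+1 * y)) ^+ m.
  by rewrite exprM -exprMn; congr (_ ^+ m); rewrite !exprMn !exprS; ring.
exact: mulI.
Qed.

(* The multiplier [a] absorbs the elements already chosen in the first ideals. *)
Lemma prod_content_sub I (T : Type) (s : seq T) (f : T -> B) (a : R) :
  radical_ideal I ->
  (forall x, content (\prod_(i <- s) f i) x -> I (a * x)) ->
  forall x, (\big[@ideal_mul R/setT]_(i <- s) content (f i)) x -> I (a * x).
Proof.
move=> radI; have [idI _] := radI.
elim: s a => [|i s IHs] a.
  by rewrite !big_nil; have [_ [_ ->] _] := hB; apply.
rewrite !big_cons => sI; apply: ideal_mul_sub (ideal_colon a idI) _ => x y fx.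
(* The induction hypothesis is applied with the multiplier [a * x]. *)
rewrite /= mulrA; apply: IHs => z.
exact: (content_mul_radical radI sI).
Qed.

Lemma n_absorbing_contract n I : ideal I ->
  n_absorbing n (ideal_ext B I) -> n_absorbing n I.
Proof.
move=> idI [[_ IBnT] absIB]; split=> [|x Ix].
  by split=> // /(ideal_ext_eqT idI).
(* The structure map is a ring morphism, so products of the [x i] can be tested in [B] and brought
   back by contraction. *)
have [|A cardA IBA] := absIB (fun i => (x i)%:A).
  by rewrite -(rmorph_prod (in_alg B)); apply: mem_ideal_ext.
exists A => //; apply: ideal_ext_alg => //.
by have := IBA; rewrite -(rmorph_prod (in_alg B)).
Qed.

Lemma strongly_n_absorbing_extend n I : radical_ideal I ->
  strongly_n_absorbing n I -> n_absorbing n (ideal_ext B I).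
Proof.
move=> radI [[idI InT] absI]; split=> [|f If].
  by split; [apply: ideal_ext_ideal | move=> /(ideal_ext_eqT idI)].
have [i||A cardA IA] := absI (fun i => content (f i)).
- exact: content_ideal.
(* The multiplier starts at [1]. *)
- move=> x fx; rewrite -[x]mul1r; apply: prod_content_sub fx => // y.
  by rewrite mul1r; apply: content_sub.
exists A => //; apply: (ideal_ext_mono IA).
by apply: ideal_ext_prod => i; have [] := hB.
Qed.

End ContentAlgebra.

Lemma eq_omega (R S : comNzRingType) (I : set R) (J : set S) :
  (I = setT <-> J = setT) ->
  (forall n, (0 < n)%N -> n_absorbing n I <-> n_absorbing n J) ->
  omega I = omega J.
Proof.
move=> /propext eqT eq_abs; rewrite /omega eqT.
(* Abstracting the predicate lets congruence reach under the existence proof on which [ex_minn]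
   depends. *)
pose least (p : pred nat) :=
  if pselect (exists n, p n) is left exn then Some (ex_minn exn) else None.
congr (if _ then _ else least _).
apply/funext => n; congr asbool; apply/propext.
by split=> -[n_gt0 abs_n]; split=> //; apply/eq_abs.
Qed.

Theorem theorem15 (R : comNzRingType) (B : comAlgType R)
    (hR : forall (n : nat) (J : set R), (0 < n)%N ->
       n_absorbing n J -> strongly_n_absorbing n J)
    (hB : content_algebra B)
    (I : set R) (hI : radical_ideal I) :
  omega (ideal_ext B I) = omega I.
Proof.
have [idI _] := hI; apply: eq_omega => [|n n_gt0].
  exact: ideal_ext_eqT.
split=> [|/(hR _ _ n_gt0)]; first exact: n_absorbing_contract.
exact: strongly_n_absorbing_extend.
Qed.
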